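(* For every family $(X_\alpha)_{\alpha\in A}$ of locally compact topological spaces, the product topology makes $X:=\prod_{\alpha\in A}X_\alpha$ a $k_{\mathbb{R}}$-space.
   Context: Terminology follows Bourbaki: compact, locally compact and completely regular spaces are Hausdorff by definition. The index set $A$ is arbitrary. A topological space $X$ is called a $k_{\mathbb{R}}$-space if $X$ is completely regular and a function $f\colon X\to\mathbb{R}$ is continuous if and only if the restriction $f|_K$ is continuous for each compact subset $K\subseteq X$ (with the subspace topology). *)

(* Defs.v *)
From HB Require Import structures.
From mathcomp Require Import all_boot all_order all_algebra.
From mathcomp Require Import all_classical all_reals all_analysis.

Set Implicit Arguments.
Unset Strict Implicit.
Unset Printing Implicit Defensive.

Import numFieldNormedType.Exports.
Local Open Scope classical_set_scope.

(* Bourbaki's terminology: locally compact and completely regular spaces are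
   Hausdorff, which [locally_compact] and [completely_regular_space] do not
   require. *)
Definition locally_compact_hausdorff (X : topologicalType) : Prop :=
  hausdorff_space X /\ locally_compact [set: X].

Definition completely_regular_hausdorff (X : topologicalType) : Prop :=
  hausdorff_space X /\ completely_regular_space X.

(* [compact K] contains no separation axiom; the subspace [K] is Hausdorff
   because [X] is. *)
Definition kR_space (R : realType) (X : topologicalType) : Prop :=
  completely_regular_hausdorff X /\
  forall f : X -> R,
    continuous f <->
    (forall K : set X, compact K -> {within K, continuous f}).

(* Main.v *)
Require Import Defs.
From HB Require Import structures.
From mathcomp Require Import all_boot all_order all_algebra.
From mathcomp Require Import all_classical all_reals all_analysis.
From mathcomp Require Import lra.

Set Implicit Arguments.
Unset Strict Implicit.
Unset Printing Implicit Defensive.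

Import Order.TTheory GRing.Theory Num.Theory.
Import numFieldNormedType.Exports.
Local Open Scope classical_set_scope.
Local Open Scope ring_scope.

(* Let [f] be continuous on compact sets and fix [x] together with compact
   neighbourhoods [K a] of the [x a]. On a compact box [f] is uniformly
   continuous, hence up to a small error it depends on finitely many coordinates
   only. The point is to find one finite [F] such that, for every [y] lying in
   [K] over [F], resetting [y] to [x] outside [F] changes [f y] by at most [e]
   ([splice_uniform_approx]); the modified points lie in the compact box with
   sides [K a], where [f] is continuous. *)

Lemma within_continuous_near (R : realType) (T : topologicalType) (f : T -> R)
    (C : set T) (x : T) (e : R) :
  {within C, continuous f} -> C x -> 0 < e ->
  \forall y \near x, C y -> `|f x - f y| < e.
Proof.
move=> fC Cx e0; have /cvgrPdist_lt/(_ e e0) := fC x.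
by rewrite /nbhs /= -nbhs_subspace_in.
Qed.

Lemma near_finite_forall (I T : Type) (G : set I) (N : set_system T)
    (P : I -> T -> Prop) : Filter N -> finite_set G ->
  (forall i, G i -> \forall t \near N, P i t) ->
  \forall t \near N, forall i, G i -> P i t.
Proof.
move=> FN /(@finite_fsetP {classic I})[D ->] NP.
by apply: filterS (@filter_bigI _ {classic I} D P N FN NP) => t Pt i /Pt.
Qed.

Section prod_topology_complements.
Variables (A : Type) (X : A -> topologicalType).
Implicit Types (F G : set A) (x y z : prod_topology X).

Lemma prod_topology_hausdorff :
  (forall a, hausdorff_space (X a)) -> hausdorff_space (prod_topology X).
Proof. by move=> hX; exact: (@hausdorff_product {classic A} X). Qed.

(** Completely regular topologies are those induced by a uniformity, and the product uniformity
    induces the product topology. *)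
Lemma prod_topology_completely_regular (R : realType) :
  (forall a, completely_regular_space (X a)) ->
  completely_regular_space (prod_topology X).
Proof.
move=> hX.
pose U a : uniformType := @completely_regular_uniformity.type R (X a) (hX a).
(* [U a] repackages the topology of [X a]: the two are equal, but convertible
   only once the record [X a] is destructed. *)
have XE : (fun a => U a : topologicalType) = X.
  by apply: functional_extensionality_dep => a; rewrite /U; case: (X a) (hX a).
have := @uniform_completely_regular R (prod_topology U).
rewrite -[in X in _ -> X]XE.
exact.
Qed.

Lemma compact_box (K : forall a, set (X a)) :
  (forall a, compact (K a)) ->
  compact [set z : prod_topology X | forall a, K a (z a)].
Proof. exact: (@tychonoff {classic A} X). Qed.

Lemma prod_topology_near x (a : A) (V : set (X a)) :
  nbhs (x a) V -> \forall y \near x, V (y a).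
Proof. exact: (@proj_continuous {classic A} X a x). Qed.

Lemma prod_topology_cvg (N : set_system (prod_topology X)) x : Filter N ->
  (forall a (V : set (X a)), nbhs (x a) V -> \forall y \near N, V (y a)) ->
  N --> x.
Proof.
move=> FN Nx; apply/cvg_sup => a V /= [_ [[U oU <-] Ux UV]].
by apply: filterS UV _; apply: Nx; exact: open_nbhs_nbhs.
Qed.

(** The sets [V] satisfying the conclusion form a filter [N] containing the preimages of coordinate
    neighbourhoods; hence [N] converges to [x], that is, contains all its neighbourhoods. *)
Lemma prod_topology_finite_dependence x (V : set (prod_topology X)) :
  nbhs x V -> exists G (W : set (prod_topology X)),
    [/\ finite_set G, nbhs x W, W `<=` V &
        forall y z, W y -> (forall a, G a -> z a = y a) -> W z].
Proof.
pose N : set_system (prod_topology X) :=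
  [set V | exists G (W : set (prod_topology X)),
    [/\ finite_set G, nbhs x W, W `<=` V &
        forall y z, W y -> (forall a, G a -> z a = y a) -> W z]].
have FN : Filter N.
  split=> [|V1 V2 [G1 [W1 [fG1 xW1 WV1 sW1]]] [G2 [W2 [fG2 xW2 WV2 sW2]]]|].
  - by exists set0, setT; split => //; exact: filterT.
  - exists (G1 `|` G2), (W1 `&` W2); split.
    + by rewrite finite_setU.
    + exact: filterI.
    + exact: setISS.
    + move=> y z [W1y W2y] zy; split.
        by apply: sW1 W1y _ => a Ga; apply: zy; left.
      by apply: sW2 W2y _ => a Ga; apply: zy; right.
  - move=> V1 V2 V12 [G [W [fG xW WV sW]]]; exists G, W; split => //.
    exact: subset_trans V12.
suff Nx : N --> x by exact: Nx.
apply: prod_topology_cvg => a U xU.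
exists [set a], [set y | U (y a)]; split => //.
- exact: prod_topology_near.
- by move=> y z /= Uy /(_ a erefl) ->.
Qed.

(* Uniform continuity on a compact set for the product uniformity, phrased
   without a uniform structure on the factors. *)
Lemma compact_finite_dependence (R : realType) (f : prod_topology X -> R)
    (C : set (prod_topology X)) (e : R) :
  compact C -> {within C, continuous f} -> 0 < e ->
  exists2 G, finite_set G & forall y z, C y -> C z ->
    (forall a, G a -> z a = y a) -> `|f y - f z| < e.
Proof.
move=> cC fC e0.
(* Near [N] means for all index sets containing some finite one; the near-covering form of
   compactness then gives one finite [G] valid on all of [C]. *)
pose N : set_system (set A) :=
  filter_from [set G | finite_set G] (fun G => [set F | G `<=` F]).
have FN : Filter N.
  apply: filter_from_filter; first by exists set0; exact: finite_set0.
  move=> G1 G2 fG1 fG2; exists (G1 `|` G2); first by rewrite /= finite_setU.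
  by move=> F /= GF; split=> a Ga; apply: GF; [left|right].
pose P F y := forall z, C y -> C z ->
  (forall a, F a -> z a = y a) -> `|f y - f z| < e.
have [|G fG GP] := (compact_near_coveringP C).1 cC _ N P FN.
  move=> x Cx.
  have : \forall y \near x, C y -> `|f x - f y| < e / 2.
    by apply: within_continuous_near; rewrite ?divr_gt0.
  move=> /prod_topology_finite_dependence[G [W [fG xW WV sW]]].
  exists (W, [set F | G `<=` F]); first by split => //=; exists G.
  move=> [y F] /= [Wy GF] z Cy Cz zy.
  have Wz : W z by apply: sW Wy _ => a /GF; exact: zy.
  have := WV _ Wy Cy; have := WV _ Wz Cz.
  rewrite !ltr_norml => /andP[? ?] /andP[? ?]; apply/andP; split; lra.
by exists G => // y z Cy Cz zy;
  exact: (GP G (@subset_refl _ G) y Cy z Cy Cz zy).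
Qed.

End prod_topology_complements.

Section splice.
Variables (A : Type) (X : A -> topologicalType).
Implicit Types (F G : set A) (x y z : prod_topology X).

Definition splice F x y : prod_topology X :=
  fun a => if `[< F a >] then y a else x a.

Lemma splice_in F x y a : F a -> splice F x y a = y a.
Proof. by rewrite /splice; case: asboolP. Qed.

Lemma splice_out F x y a : ~ F a -> splice F x y a = x a.
Proof. by rewrite /splice; case: asboolP. Qed.

Lemma splice_cvg F x : splice F x y @[y --> x] --> x.
Proof.
apply: (@prod_topology_cvg _ _ _ x (fmap_filter _ (nbhs_filter x))) => a V xV.
rewrite near_simpl.
have [Fa|nFa] := pselect (F a); near=> y.
  by rewrite splice_in//; near: y; exact: prod_topology_near.
by rewrite splice_out//; exact: nbhs_singleton.
Unshelve. all: by end_near. Qed.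

Lemma box_splice (K : forall a, set (X a)) F x y :
  (forall a, K a (x a)) -> (forall a, F a -> K a (y a)) ->
  forall a, K a (splice F x y a).
Proof. by move=> Kx Ky a; rewrite /splice; case: asboolP => // /Ky. Qed.

End splice.

Section kR_continuous.
Variables (R : realType) (A : Type) (X : A -> topologicalType).
Variable f : prod_topology X -> R.
Hypothesis fK : forall K, compact K -> {within K, continuous f}.
Implicit Types (F G : set A) (x y z : prod_topology X).

(* Continuity of [f] on the compact box with sides [{x a, y a}] lets one replace
   [y] by a point differing from [x] at finitely many indices only. *)
Lemma splice_approx x y e : 0 < e -> exists2 G, finite_set G &
  forall H, G `<=` H -> `|f y - f (splice H x y)| < e.
Proof.
move=> e0.
pose B := [set z : prod_topology X | forall a, (z a = x a) \/ z a = y a].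
have cB : compact B.
  apply: (@compact_box _ _ (fun a => [set u | u = x a] `|` [set u | u = y a])).
  by move=> a; apply: compactU; exact: compact_set1.
have [G fG GP] := compact_finite_dependence cB (fK cB) e0.
exists G => // H GH; apply: GP => [a|a|a /GH Ha]; first by right.
  by rewrite /splice; case: ifP => _; [right|left].
by rewrite splice_in.
Qed.

(* Otherwise one obtains [z n] with finite supports (relative to [x]) contained
   in [D n.+1], where [D] is increasing, such that [z n] lies in [K] over [D n]
   and yet [f] distinguishes [z n] from its truncation to [D n]. At each index
   at most one [z n] leaves [K], so all these points lie in a compact box, which
   contradicts [compact_finite_dependence]. *)
Lemma splice_uniform_approx (K : forall a, set (X a)) x e :
  (forall a, compact (K a)) -> (forall a, K a (x a)) -> 0 < e ->
  exists2 F, finite_set F & forall y, (forall a, F a -> K a (y a)) ->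
    `|f y - f (splice F x y)| <= e.
Proof.
move=> cK Kx e0; apply: contrapT => noF.
have step F : exists Hz : set A * prod_topology X, finite_set F ->
    [/\ finite_set Hz.1, F `<=` Hz.1, forall a, ~ Hz.1 a -> Hz.2 a = x a,
        forall a, F a -> K a (Hz.2 a) &
        e / 2 < `|f Hz.2 - f (splice F x Hz.2)|].
  (* The pair [(F, x)] is a dummy value for infinite [F], so that [choice] yields a total
     function. *)
  have [fF|] := pselect (finite_set F); last by move=> nfF; exists (F, x).
  have [y Ky yF] : exists2 y, forall a, F a -> K a (y a) &
      e < `|f y - f (splice F x y)|.
    apply: contrapT => noy; apply: noF; exists F => // y Ky.
    by rewrite leNgt; apply/negP => yF; apply: noy; exists y.
  have [G fG GP] := @splice_approx x y (e / 2) (divr_gt0 e0 (ltr0Sn _ 1)).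
  (* Truncating [y] to the union moves [f y] by less than [e / 2], so more than [e / 2] of the gap
     survives. *)
  exists (F `|` G, splice (F `|` G) x y) => _ /=; split.
  - by rewrite finite_setU.
  - by move=> a; left.
  - by move=> a; exact: splice_out.
  - by move=> a Fa; rewrite splice_in; [exact: Ky|left].
  - have -> : splice F x (splice (F `|` G) x y) = splice F x y.
      apply: functional_extensionality_dep => a.
      have [Fa|nFa] := pselect (F a); last by rewrite !splice_out.
      by rewrite !splice_in//; left.
    have := GP (F `|` G) (@subsetUr _ _ _).
    have := ler_distD (f (splice (F `|` G) x y)) (f y) (f (splice F x y)).
    by move: yF; lra.
have {step}[g gP] := choice step.
pose D n := iter n (fun F => (g F).1) set0.
pose z n := (g (D n)).2.
have fD n : finite_set (D n).
  by elim: n => [|n /gP[]]//; exact: finite_set0.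
have Dle m n : (m <= n)%N -> D m `<=` D n.
  move=> /subnK <-; elim: (n - m)%N => // k IHk.
  by have [_ DS _ _ _] := gP _ (fD (k + m)%N); exact: subset_trans DS.
have zout n a : ~ D n.+1 a -> z n a = x a.
  by have [_ _ + _ _] := gP _ (fD n); exact.
have zK n a : D n a -> K a (z n a).
  by have [_ _ _ + _] := gP _ (fD n); exact.
have zf n : e / 2 < `|f (z n) - f (splice (D n) x (z n))|.
  by have [] := gP _ (fD n).
(* If [z n] leaves [K a], then [a] is in [D n.+1] but not in [D n]: earlier points equal [x] at [a],
   later ones lie in [K a]. So [c a] can be that single value. *)
have /all_sig[c cP] a : {c | forall n, K a (z n a) \/ z n a = c}.
  apply: cid.
  have [[n [Da nK]]|nDa] := pselect (exists n, D n.+1 a /\ ~ K a (z n a)).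
    exists (z n a) => m; have [mn|nm|->] := ltngtP m n; last by right.
      left; rewrite zout// => /(Dle _ _ mn) /zK; exact: nK.
    by left; apply: zK; exact: Dle nm _ Da.
  exists (x a) => m; have [Da|/zout] := pselect (D m.+1 a); last by right.
  by left; apply: contrapT => nK; apply: nDa; exists m.
pose C := [set y : prod_topology X | forall a, K a (y a) \/ y a = c a].
have cC : compact C.
  apply: (@compact_box _ _ (fun a => K a `|` [set u | u = c a])).
  by move=> a; apply: compactU; [exact: cK|exact: compact_set1].
have [G fG GP] :=
  compact_finite_dependence cC (fK cC) (divr_gt0 e0 (ltr0Sn R 1)).
(* As [D] increases and [G] is finite, the trace of [D n] on [G] stabilizes. Hence [z N] equals [x]
   on [G] outside [D N], so truncating it to [D N] changes nothing on [G]. *)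
have [N NP] : exists N, forall a n, G a -> D n a -> D N a.
  have [N _ NP] : \forall N \near \oo, forall a, G a ->
      (exists n, D n a) -> D N a.
    apply: near_finite_forall => // a _.
    have [[n Da]|nD] := pselect (exists n, D n a); last by apply: nearW.
    by exists n => // m /= nm _; exact: Dle nm _ Da.
  by exists N => a n Ga Da; apply: (NP N (leqnn N) a Ga); exists n.
have := zf N; rewrite ltNge => /negP; apply; apply/ltW/GP => [a|a|a Ga].
- exact: cP.
- by rewrite /splice; case: ifP => _; [exact: cP|left].
- have [Da|nDa] := pselect (D N a); first by rewrite splice_in.
  by rewrite splice_out// zout// => /(NP _ _ Ga).
Qed.

(** For [y] near [x], passing to [splice F x y] costs at most [e / 2]; that point lies in the
    compact box and tends to [x] with [y], so continuity on the box bounds the rest. *)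
Lemma kR_continuous : (forall a, locally_compact [set: X a]) -> continuous f.
Proof.
move=> lcX x.
have /all_sig[K KP] a : {K : set (X a) | nbhs (x a) K /\ compact K}.
  apply: cid; have [K] := lcX a (x a) I; rewrite withinET => xK [cK _].
  by exists K.
have cK a : compact (K a) by have [] := KP a.
have Kx a : K a (x a) by have [/nbhs_singleton] := KP a.
apply/(cvgrPdist_lt (FF := nbhs_filter x)) => e e0.
have e20 : 0 < e / 2 by rewrite divr_gt0.
have [F fF FP] := splice_uniform_approx cK Kx e20.
pose C := [set y : prod_topology X | forall a, K a (y a)].
have xC : \forall y \near x, C y -> `|f x - f y| < e / 2.
  by apply: within_continuous_near => //; exact/fK/compact_box.
have xs : \forall y \near x,
    C (splice F x y) -> `|f x - f (splice F x y)| < e / 2.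
  exact: (@splice_cvg _ _ F x _ xC).
have xF : \forall y \near x, forall a, F a -> K a (y a).
  apply: near_finite_forall (nbhs_filter x) fF _ => a _.
  apply: prod_topology_near.
  by have [] := KP a.
apply: filterS2 xs xF => y xs yF.
have := FP y yF; have := xs (box_splice Kx yF).
have := ler_distD (f (splice F x y)) (f x) (f y).
rewrite [`|f y - _|]distrC; lra.
Qed.

End kR_continuous.

Theorem mainTheorem2 (R : realType) (A : Type) (X : A -> topologicalType)
  (hX : forall a : A, locally_compact_hausdorff (X a)) :
  kR_space R (prod_topology X).
Proof.
have hsX a : hausdorff_space (X a) by have [] := hX a.
have lcX a : locally_compact [set: X a] by have [] := hX a.
split; first split; first exact: prod_topology_hausdorff.
  apply: (@prod_topology_completely_regular _ _ R) => a.
  exact: (@locally_compact_completely_regular _ R).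
move=> f; split=> [cf K _|fK]; first exact: continuous_subspaceT.
exact: kR_continuous.
Qed.
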